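(* Let $\mathcal{F}$ be a $\Delta$-filter on a semigroup $G$ and let $R \subseteq G^2$ be a binary relation such that $$\forall^\mathcal{F} h\ \forall^\mathcal{F} g\ R(g,gh),$$ i.e. the set of $h\in G$ for which $\{g \in G : R(g,gh)\}$ is $\mathcal{F}$-large is itself $\mathcal{F}$-large. Then for any $n \in \mathbb{N}$ there is a sequence $(g_i)_{i \le n}$ of elements of $G$ such that $R(g_j,g_i)$ holds for all $i<j\le n$. Moreover, if $A \subseteq G$ is an $n$-recurrent set (with respect to $\mathcal{F}$), the sequence $(g_i)_{i\le n}$ can be chosen inside $A$.
   Context: A filter $\mathcal{F}$ on a set $S$ is a nonempty family of subsets of $S$ not containing $\emptyset$, closed upward and under finite intersections. A set $A$ is $\mathcal{F}$-large if $A\in\mathcal{F}$, $\mathcal{F}$-small if $S\setminus A\in\mathcal{F}$, and $\mathcal{F}$-positive if it is not $\mathcal{F}$-small. ''$\forall^\mathcal{F} x\, P(x)$'' means the set of $x$ with $\neg P(x)$ is $\mathcal{F}$-small; ''$\exists^\mathcal{F} x \in B\, P(x)$'' means the set of $x\in B$ with $P(x)$ is $\mathcal{F}$-positive. Write $A \sim_\mathcal{F} B$ if $A\,\triangle\, B$ is $\mathcal{F}$-small, and $\tilde A \precsim_\mathcal{F} A$ if $\tilde A \sim_\mathcal{F} A$ and $\tilde A \subseteq A$. For a semigroup $G$, $A\subseteq G$, $g\in G$: $Ag^{-1} := \{h \in G : hg \in A\}$ and $\partial_g A := A \cap Ag^{-1}$. Recurrence with respect to $\mathcal{F}$: $A$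 is $0$-recurrent if it is $\mathcal{F}$-positive; $\Delta^0(A)=A$; for $n\ge1$, $\Delta^n(A) := \{g \in G : \partial_g A \text{ is } (n-1)\text{-recurrent}\}$, and $A$ is $n$-recurrent if $\Delta^n(A)$ is $\mathcal{F}$-positive. Write $\Delta(A)=\Delta^1(A)$. $\mathcal{F}$ respects recurrence if for all $n\ge1$ and $A \sim_\mathcal{F} \tilde A$, $A$ is $n$-recurrent iff $\tilde A$ is $n$-recurrent. $n$-thick in $\Delta(A)$: every $D$ is $0$-thick in $\Delta(A)$ for every $A$; for $n \ge 1$, $D$ is $n$-thick in $\Delta(A)$ if for every $n$-recurrent $\tilde A \precsim_\mathcal{F} A$, $\exists^\mathcal{F} g \in D$ such that $\partial_g \tilde A$ is $(n-1)$-recurrent and $\partial_g D$ is $(n-1)$-thick in $\Delta(\partial_g \tilde A)$. A $\Delta$-filter is a filter $\mathcal{F}$ on $G$ that respects recurrence and such that every $\mathcal{F}$-large $H$ is $n$-thick in $\Delta(A)$ for every $A \subseteq G$ and $n\ge 0$. *)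

(* Defs.v *)
From HB Require Import structures.
From mathcomp Require Import all_boot.
From mathcomp Require Import boolp classical_sets filter.

Set Implicit Arguments.
Unset Strict Implicit.
Unset Printing Implicit Defensive.

Local Open Scope classical_set_scope.

Section FilterNotions.
Context {S : Type} (F : set_system S).
Implicit Types (A B : set S) (P : S -> Prop).

Definition large A : Prop := F A.
Definition small A : Prop := F (~` A).
Definition positive A : Prop := ~ small A.

Definition forallF P : Prop := small [set x | ~ P x].
Definition existsF_in B P : Prop := positive [set x | B x /\ P x].

Definition simF A B : Prop := small (A `+` B).
Definition precsimF A' A : Prop := simF A' A /\ A' `<=` A.

End FilterNotions.

Section Recurrence.
Context {G : semigroupType}.
Implicit Types (A D H : set G) (g h : G).

(* [rtranslate A g] is A g^{-1}; no inverse of g is assumed to exist. *)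
Definition rtranslate A g : set G := [set h | A (h * g)%g].

Definition partial g A : set G := A `&` rtranslate A g.

Variable F : set_system G.

(* The recursive call unfolds "[partial g A] is m-recurrent", see [recurrent]. *)
Fixpoint Delta (n : nat) A : set G :=
  match n with
  | 0 => A
  | m.+1 => [set g | positive F (Delta m (partial g A))]
  end.

Definition recurrent (n : nat) A : Prop := positive F (Delta n A).

Definition respects_recurrence : Prop :=
  forall (n : nat) A A', (1 <= n)%N -> simF F A A' ->
    (recurrent n A <-> recurrent n A').

(* [thick n D A] reads "D is n-thick in Delta(A)". *)
Fixpoint thick (n : nat) D A : Prop :=
  match n with
  | 0 => True
  | m.+1 =>
      forall A', precsimF F A' A -> recurrent m.+1 A' ->
        existsF_in F D (fun g =>
          recurrent m (partial g A') /\ thick m (partial g D) (partial g A'))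
  end.

(* [ProperFilter] contains [setT]; together with upward closure this is the
   same as being a nonempty family. *)
Definition Delta_filter : Prop :=
  [/\ ProperFilter F, respects_recurrence &
      forall H, large F H -> forall A (n : nat), thick n H A].

End Recurrence.

(* Main.v *)
Require Import Defs.
From HB Require Import structures.
From mathcomp Require Import all_boot.
From mathcomp Require Import boolp classical_sets filter.

(** Let [H] be the large set of [h] such that [R g (g * h)] for almost all [g].
    Starting from [A] and [H], use thickness to pick [a_1], [a_2], ... in turn,
    replacing the current sets [A] and [D] by [partial a_k A] and
    [partial a_k D].  The products [a_k], [a_k a_(k-1)], ..., [a_k ... a_1] then
    all lie in [H], so after each step [A] can be shrunk, up to a small set, to
    points [x] with [R x (x * l)] for each of these products [l]; recurrence and
    thickness survive the shrinking.  When the recurrence is used up, any point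
    [x] of the remaining positive set gives the sequence
    [x a_n ... a_1], ..., [x a_n], [x]. *)

Set Implicit Arguments.
Unset Strict Implicit.

Local Open Scope classical_set_scope.

Section Filters.
Context {S : Type} {F : set_system S} {FF : ProperFilter F}.
Implicit Types A B : set S.

Lemma positive_nonempty A : positive F A -> A !=set0.
Proof.
move=> posA; apply: contrapT => /nonemptyPn A0; apply: posA.
by rewrite /small A0 setC0; exact: filterT.
Qed.

Lemma positiveT : positive F setT.
Proof. by rewrite /positive /small setCT; exact: filter_not_empty. Qed.

Lemma positive_setI A B : F B -> positive F A -> positive F (A `&` B).
Proof.
move=> FB posA smallAB; apply: posA.
by apply: filterS2 FB smallAB => x Bx nABx Ax; exact: nABx.
Qed.

Lemma precsimF_setI A B : F B -> precsimF F (A `&` B) A.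
Proof.
move=> FB; split; last exact: subIsetl.
by apply: filterS FB => x Bx [[[]]|[Ax]] //; apply.
Qed.

Lemma precsimF_refl A : precsimF F A A.
Proof. by rewrite -{1}(setIT A); apply: precsimF_setI; exact: filterT. Qed.

Lemma precsimF_trans A A' A'' :
  precsimF F A'' A' -> precsimF F A' A -> precsimF F A'' A.
Proof.
rewrite /precsimF /simF /small => -[sim2 sub2] [sim1 sub1]; split; last exact: subset_trans sub1.
apply: filterS2 sim2 sim1 => x n2 n1 [[A2x nAx]|[Ax nA2x]].
  by apply/nAx/sub1/sub2.
by apply: n1; right; split => // A1x; apply: n2; right.
Qed.

Lemma filter_all_seq (T : Type) (P : S -> pred T) (s : seq T) :
  all (fun l => `[< F [set x | P x l] >]) s -> F [set x | all (P x) s].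
Proof.
elim: s => [_|l s IH /= /andP[/asboolP Fl /IH Fs]]; first exact: filterE.
by apply: filterS2 Fl Fs => x /= -> ->.
Qed.

End Filters.

Section Chains.
Context {G : semigroupType} {F : set_system G} {FF : ProperFilter F}.
Implicit Types (A D : set G) (R : G -> G -> Prop).

Lemma recurrentT n : recurrent F n setT.
Proof.
elim: n => [|n IH]; first exact: positiveT.
rewrite /recurrent /=; suff -> : [set g | positive F (Delta F n (partial g setT))] = setT.
  exact: positiveT.
apply/seteqP; split => // g _ /=.
suff -> : partial g [set: G] = setT by exact: IH.
exact/seteqP.
Qed.

(** By transitivity the sets to be tested for [A'] are among those tested for [A]. *)
Lemma thick_precsim n D A A' : precsimF F A' A -> thick F n D A -> thick F n D A'.
Proof.
case: n => [//|n] sA'A thD B sBA'.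
exact: thD (precsimF_trans sBA' sA'A).
Qed.

(** Level 0 is treated apart, since [respects_recurrence] speaks only of levels at least 1. *)
Lemma recurrent_setI n A B : respects_recurrence F -> F B ->
  recurrent F n A -> recurrent F n (A `&` B).
Proof.
case: n => [|n] resp FB recA; first exact: positive_setI.
by apply/(resp n.+1 _ A) => //; have [] := precsimF_setI A FB.
Qed.

(** Invariant of the induction on [n]: [L] lists the products of the elements chosen so far, each
    [x] in [A] heads a finished chain inside the original set [A0], and each [d] in [D] is an
    admissible next choice. The sum [n + size L] stays constant. *)
Lemma recurrent_thick_chain R (A0 : set G) n A D (L : seq G) :
    respects_recurrence F ->
    (forall x, A x ->
      all (fun y => `[< A0 y >]) (x :: [seq (x * l)%g | l <- L]) &&
      pairwise (fun y z => `[< R y z >]) (x :: [seq (x * l)%g | l <- L])) ->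
    (forall d, D d -> all (fun l => `[< F [set g | R g (g * l)%g] >])
                          (d :: [seq (d * l)%g | l <- L])) ->
    recurrent F n A -> thick F n D A ->
  exists s : seq G, [/\ size s = (n + size L).+1, all (fun y => `[< A0 y >]) s
    & pairwise (fun y z => `[< R y z >]) s].
Proof.
move=> resp; elim: n A D L => [|n IH] A D L chainA largeD recA thD.
  have [x /chainA/andP[A0x Rx]] := positive_nonempty recA.
  by exists (x :: [seq (x * l)%g | l <- L]); rewrite /= size_map.
have [g [Dg [recg thg]]] := positive_nonempty (thD A (precsimF_refl A) recA).
set L' := g :: [seq (g * l)%g | l <- L].
have FR : F [set x | all (fun l => `[< R x (x * l)%g >]) L'].
  apply: filter_all_seq; apply: sub_all (largeD g Dg) => l /asboolP Fl.
  by apply/asboolP; apply: filterS Fl => x ?; exact/asboolP.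
(* By associativity the new chain below [x] is the old chain headed by [x * g], so only the
   relations from [x] itself are new; [FR] supplies them. *)
have mapL' x : [seq (x * l)%g | l <- L'] =
               (x * g)%g :: [seq (x * g * l)%g | l <- L].
  by rewrite /= -map_comp; congr (_ :: _); apply: eq_map => l /=; rewrite mulgA.
have -> : (n.+1 + size L = n + size L')%N by rewrite /= size_map addSnnS.
apply: (IH _ (partial g D) L' _ _ (recurrent_setI resp FR recg)
  (thick_precsim (precsimF_setI _ FR) thg)).
- move=> x [[Ax /chainA/andP[allxg pairxg]] Rx].
  have /andP[/andP[A0x _] _] := chainA x Ax.
  rewrite -mapL' in allxg pairxg.
  apply/andP; split; first by apply/andP.
  by rewrite pairwise_cons pairxg andbT all_map.
- move=> d [/largeD/andP[dH _] /largeD dgH].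
  by rewrite mapL' /= dH; exact: dgH.
Qed.

End Chains.

Theorem mainTheorem1 (G : semigroupType) (F : set_system G)
    (FD : Delta_filter F) (R : G -> G -> Prop)
    (hR : forallF F (fun h : G => forallF F (fun g : G => R g (g * h)%g))) :
  (forall n : nat, exists s : 'I_n.+1 -> G,
      forall i j : 'I_n.+1, (i < j)%N -> R (s j) (s i)) /\
  (forall (n : nat) (A : set G), recurrent F n A ->
      exists s : 'I_n.+1 -> G,
        (forall i : 'I_n.+1, A (s i)) /\
        (forall i j : 'I_n.+1, (i < j)%N -> R (s j) (s i))).
Proof.
have [FF resp thickF] := FD.
suff main n A : recurrent F n A -> exists s : 'I_n.+1 -> G,
    (forall i, A (s i)) /\ (forall i j : 'I_n.+1, (i < j)%N -> R (s j) (s i)).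
  split=> // n; have [s [_ Rs]] := main n _ (@recurrentT G F FF n).
  by exists s.
move=> recA; pose H := [set h | F [set g | R g (g * h)%g]].
have FH : F H.
  rewrite /forallF /small in hR.
  apply: filterS hR => h /contrapT Fh.
  by apply: filterS Fh => g /contrapT.
have [||s []] := @recurrent_thick_chain G F FF R A n A H [::] resp _ _ recA
  (thickF H FH A n).
- by move=> x Ax /=; rewrite !andbT; exact/asboolP.
- by move=> d Hd /=; rewrite andbT; exact/asboolP.
(* A proper filter lives on a nonempty set; [x0] is only the default of [nth]. *)
have [x0 _] := positive_nonempty (@positiveT _ F FF).
rewrite addn0 => sz_s /all_nthP-/(_ x0) As /(pairwiseP x0) Rs.
(* In [s] earlier entries are related to later ones; the required order is the opposite. *)
exists (fun i => nth x0 s (rev_ord i)); split=> [i|i j ltij].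
  by apply/asboolP/As; rewrite sz_s.
apply/asboolP/Rs; rewrite ?inE ?sz_s /= ?subSS ?ltnS ?leq_subr //.
by rewrite ltn_sub2l // (leq_trans ltij) // -ltnS.
Qed.
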